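(* Let $\mathcal{H}$ be a real Hilbert space, $A:\mathcal{H}\rightrightarrows\mathcal{H}$ a maximally monotone operator, $D:\mathcal{H}\to\mathcal{H}$ a monotone and $\eta^{-1}$-Lipschitz continuous operator with $\eta>0$, $B:\mathcal{H}\to\mathcal{H}$ a monotone and $\mu^{-1}$-Lipschitz continuous operator with $\mu>0$, and suppose $C=\operatorname{zer}B\neq\emptyset$. Let $(\lambda_n)_{n\ge1}$ and $(\beta_n)_{n\ge1}$ be sequences of positive real numbers, let $x_1\in\mathcal{H}$ and let $(x_n)_{n\ge1}$, $(p_n)_{n\ge1}$ be generated, for all $n\ge1$, by $$p_n=J_{\lambda_nA}(x_n-\lambda_nDx_n-\lambda_n\beta_nBx_n),\qquad x_{n+1}=\lambda_n\beta_n(Bx_n-Bp_n)+\lambda_n(Dx_n-Dp_n)+p_n .$$ Set $\tau_n=\sum_{k=1}^n\lambda_k$ and $z_n=\frac1{\tau_n}\sum_{k=1}^n\lambda_kx_k$. Assume that: (1) $A+N_C$ is maximally monotone and $\operatorname{zer}(A+D+N_C)\neq\emptyset$; (2) for every $p\in\operatorname{ran}N_C$, $\ \sum_{n\ge1}\lambda_n\beta_n\left[\sup_{u\in C}\varphi_B\left(u,\frac{p}{\beta_n}\right)-\sigma_C\left(\frac{p}{\beta_n}\right)\right]<+\infty$; (3) $(\lambda_n)_{n\ge1}\in\ell^2\setminus\ell^1$; (4) $\limsup_{n\to+\infty}\left(\frac{\lambda_n\beta_n}{\mu}+\frac{\lambda_n}{\eta}\right)<1$. Then $(z_n)_{n\ge1}$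 converges weakly to an element of $\operatorname{zer}(A+D+N_C)$ as $n\to+\infty$.
   Context: For a set-valued operator $M:\mathcal{H}\rightrightarrows\mathcal{H}$: $\operatorname{Gr}M=\{(x,u):u\in Mx\}$, $\operatorname{ran}M=\{u:\exists x,\ u\in Mx\}$, $\operatorname{zer}M=\{x:0\in Mx\}$, and $J_M=(\mathrm{Id}+M)^{-1}$ is the resolvent (single-valued and everywhere defined when $M$ is maximally monotone). $M$ is monotone if $\langle x-y,u-v\rangle\ge0$ for all $(x,u),(y,v)\in\operatorname{Gr}M$; maximally monotone if its graph has no proper monotone extension. The normal cone of $C$ is $N_C(x)=\{u:\langle u,y-x\rangle\le0\ \forall y\in C\}$ if $x\in C$ and $N_C(x)=\emptyset$ otherwise; the support function is $\sigma_C(u)=\sup_{y\in C}\langle y,u\rangle$. The Fitzpatrick function of a monotone operator $M$ is $\varphi_M(x,u)=\sup_{(y,v)\in\operatorname{Gr}M}\{\langle x,v\rangle+\langle y,u\rangle-\langle y,v\rangle\}$, with values in the extended reals. *)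

(* Defs.v *)
From HB Require Import structures.
From mathcomp Require Import all_boot all_order all_algebra.
From mathcomp Require Import all_classical all_reals all_analysis.

Set Implicit Arguments.
Unset Strict Implicit.
Unset Printing Implicit Defensive.

Import Order.TTheory GRing.Theory Num.Theory.
Import numFieldNormedType.Exports.

Local Open Scope classical_set_scope.
Local Open Scope ring_scope.

(* A real Hilbert space: the norm of a complete normed space comes from a
   symmetric positive definite bilinear form. *)
HB.mixin Record CompleteNormedModule_isHilbert (R : realType) H
    of CompleteNormedModule R H := {
  inner : {dot H for (@idfun R)} ;
  inner_norm : forall x : H, inner x x = `|x| ^+ 2
}.

#[short(type="hilbertType")]
HB.structure Definition Hilbert (R : realType) :=
  {H of CompleteNormedModule R H & CompleteNormedModule_isHilbert R H}.

Notation "<| x , y |>" := (inner x y)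
  (at level 0, x at level 99, y at level 99, format "<| x ,  y |>")
  : ring_scope.

Section SetValuedOperators.
Context {R : realType} {H : hilbertType R}.
Implicit Types (M N : H -> set H) (T : H -> H) (C : set H) (x y u v p : H).

Definition gr M : set (H * H) := [set xu | M xu.1 xu.2].
Definition ran M : set H := [set u | exists x, M x u].
Definition zer M : set H := [set x | M x 0].

Definition single T : H -> set H := fun x => [set T x].
Definition add_op M N : H -> set H := fun x => [set u + v | u in M x & v in N x].
Definition scale_op (a : R) M : H -> set H := fun x => [set a *: u | u in M x].
Definition inv_op M : H -> set H := fun u => [set x | M x u].

Definition monotone_op M : Prop :=
  forall x u y v, gr M (x, u) -> gr M (y, v) -> 0 <= <| x - y, u - v |>.

Definition maximally_monotone M : Prop :=
  monotone_op M /\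
  forall N, monotone_op N -> gr M `<=` gr N -> gr N = gr M.

(* Set-valued: J_M y is a singleton for every y when M is maximally monotone. *)
Definition resolvent M : H -> set H := inv_op (add_op (single id) M).

Definition normal_cone C : H -> set H :=
  fun x => [set u | C x /\ forall y, C y -> <| u, y - x |> <= 0].

Definition support_fun C u : \bar R := ereal_sup [set <| y, u |>%:E | y in C].

(* [yv] ranges over the pairs (y, v) of the graph of M. *)
Definition fitzpatrick M x u : \bar R :=
  ereal_sup [set (<| x, yv.2 |> + <| yv.1, u |> - <| yv.1, yv.2 |>)%:E
            | yv in gr M].

Definition weak_cvg (z : nat -> H) (l : H) : Prop :=
  forall u, <| z n, u |> @[n --> \oo] --> <| l, u |>.

End SetValuedOperators.

(* Sequences are indexed from 1; the value at 0 is ignored. *)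
Definition ell {R : realType} (q : nat) (a : nat -> R) : Prop :=
  (\sum_(1 <= n <oo) (`|a n| ^+ q)%:E < +oo)%E.

(* Main.v *)
(* Tseng's step gives, for u in C, v in A u, q in N_C u and w = v + D u + q,
     |x_(n+1) - u|^2 + (1 - c_n^2) |x_n - p_n|^2
       <= |x_n - u|^2 + 2 g_n + 2 lam_n <w, u - p_n>,
   where c_n = lam_n beta_n / mu + lam_n / eta and g_n is the n-th term of the
   series in (2).  With w = 0, |x_n - u| converges and x_n - p_n tends to 0; for
   a general w, averaging gives 0 <= <w, u - l> for every weak limit l of (z_n)
   along an ultrafilter.  By Minty's theorem for A + N_C and a fixed-point
   argument for D, l is a zero of A + D + N_C.  Two such limits l1, l2 coincide
   because <x_n, l1 - l2> converges, hence so do its averages <z_n, l1 - l2>. *)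
Require Import Defs.
From mathcomp Require Import all_boot all_order all_algebra.
From mathcomp Require Import all_classical all_reals all_analysis.
From mathcomp Require Import ring lra.

Import Order.TTheory GRing.Theory Num.Theory.
Import numFieldNormedType.Exports.

Local Open Scope classical_set_scope.
Local Open Scope ring_scope.

(** * Bilinear algebra of the inner product and the Cauchy-Schwarz inequality *)

Lemma innerDl {R : realType} {H : hilbertType R} (x y z : H) :
  <| x + y, z |> = <| x, z |> + <| y, z |>.
Proof. exact: linearDl. Qed.

Lemma innerDr {R : realType} {H : hilbertType R} (x y z : H) :
  <| z, x + y |> = <| z, x |> + <| z, y |>.
Proof. exact: linearDr. Qed.

Lemma innerNl {R : realType} {H : hilbertType R} (x y : H) :
  <| - x, y |> = - <| x, y |>.
Proof. exact: linearNl. Qed.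

Lemma innerNr {R : realType} {H : hilbertType R} (x y : H) :
  <| x, - y |> = - <| x, y |>.
Proof. exact: linearNr. Qed.

Lemma innerZl {R : realType} {H : hilbertType R} (a : R) (x y : H) :
  <| a *: x, y |> = a * <| x, y |>.
Proof. exact: linearZl_LR. Qed.

Lemma innerZr {R : realType} {H : hilbertType R} (a : R) (x y : H) :
  <| x, a *: y |> = a * <| x, y |>.
Proof. exact: linearZr_LR. Qed.

Lemma inner0l {R : realType} {H : hilbertType R} (x : H) : <| 0, x |> = 0.
Proof. exact: linear0l. Qed.

Lemma inner0r {R : realType} {H : hilbertType R} (x : H) : <| x, 0 |> = 0.
Proof. exact: linear0r. Qed.

Lemma innerC {R : realType} {H : hilbertType R} (x y : H) :
  <| x, y |> = <| y, x |>.
Proof. by by rewrite hermC expr0 mul1r. Qed.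

Definition innerE {R : realType} {H : hilbertType R} :=
  (@innerDl R H, @innerDr R H, @innerNl R H, @innerNr R H,
   @innerZl R H, @innerZr R H).

Lemma inner_suml {R : realType} {H : hilbertType R} (I : Type) (r : seq I)
    (f : I -> H) (y : H) :
  <| \sum_(i <- r) f i, y |> = \sum_(i <- r) <| f i, y |>.
Proof.
elim: r => [|i r ih]; first by rewrite !big_nil inner0l.
by rewrite !big_cons innerDl ih.
Qed.

Lemma cauchy_schwarz {R : realType} {H : hilbertType R} (x y : H) :
  `|<| x, y |>| <= `|x| * `|y|.
Proof.
have [->|y0] := eqVneq y 0; first by rewrite inner0r !normr0 mulr0.
have ny : 0 < `|y| ^+ 2 by rewrite exprn_gt0 // normr_gt0.
rewrite -(@ler_pXn2r _ 2) ?nnegrE ?mulr_ge0 // exprMn real_normK ?num_real //.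
rewrite -(ler_pM2r ny).
(* The vector is [|y| ^+ 2] times the component of [x] orthogonal to [y]; this scaling avoids a
   quotient. *)
have : 0 <= `|(`|y| ^+ 2) *: x - <| x, y |> *: y| ^+ 2 by rewrite sqr_ge0.
rewrite -[X in 0 <= X]inner_norm !innerE (innerC y x) !inner_norm.
set a := `|y|^+2; set b := `|x|^+2; set c := <|x, y|>.
rewrite [X in 0 <= X](_ : _ = a * (b * a - c ^+ 2)); last by ring.
by rewrite pmulr_rge0 // subr_ge0 ler_pM2r.
Qed.

Lemma inner_cvgl {R : realType} {H : hilbertType R} (y l : H) (x : nat -> H) :
  x @ \oo --> l -> <| x n, y |> @[n --> \oo] --> <| l, y |>.
Proof.
move=> xl; apply/cvgrPdist_le => e e0.
have d0 : 0 < e / (`|y| + 1) by rewrite divr_gt0 // ltr_wpDl.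
move/cvgrPdist_le : xl => /(_ _ d0); apply: filterS => n hn.
rewrite -innerNl -innerDl (le_trans (cauchy_schwarz _ _))//.
rewrite (le_trans (ler_wpM2r (normr_ge0 _) hn))//.
rewrite mulrAC ler_pdivrMr ?ltr_wpDl// ler_wpM2l ?ltW//.
lra.
Qed.

(** * Minimization of strongly convex functions and Riesz representation *)

Lemma seq_cauchy_cvg {R : realType} {E : completeNormedModType R} (x : nat -> E) :
  (forall e : R, 0 < e -> exists N, forall n, (N <= n)%N -> `|x N - x n| < e) ->
  exists l : E, x @ \oo --> l.
Proof.
move=> xc; suff xl : cvgn x by exists (limn x).
apply: cauchy_cvg; apply: cauchy_exP => e e0.
have [N xN] := xc _ e0; exists (x N); exists N => // n /= Nn.
by rewrite -ball_normE; exact: xN.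
Qed.

(** The function minimized is the supremum of the [G i]; it may be infinite, so it is handled
    through its real upper bounds [r]. The midpoint inequality makes a minimizing sequence Cauchy in
    both variables, and continuity of each [G i] carries the bounds to the limit. *)
Lemma sup_strongly_convex_min {R : realType} {E F : completeNormedModType R}
    (I : Type) (G : I -> E -> F -> R) (c m : R) :
  0 < c ->
  (exists x u r, forall i, G i x u <= r) ->
  (forall x u r, (forall i, G i x u <= r) -> m <= r) ->
  (forall i x y u v, G i (2^-1 *: (x + y)) (2^-1 *: (u + v)) <=
    (G i x u + G i y v) / 2 - c * (`|x - y| ^+ 2 + `|u - v| ^+ 2)) ->
  (forall i (x : nat -> E) (u : nat -> F) a b, x @ \oo --> a -> u @ \oo --> b ->
    G i (x n) (u n) @[n --> \oo] --> G i a b) ->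
  exists x u r, (forall i, G i x u <= r) /\
    forall y v s, (forall i, G i y v <= s) -> r <= s.
Proof.
move=> c0 [x0 [u0 [r0 Gr0]]] Gm Gc Gcont.
pose V := [set r | exists x u, forall i, G i x u <= r].
have Vinf : has_inf V.
  split; first by exists r0, x0, u0.
  by exists m => r [x [u h]]; exact: Gm h.
pose s := inf V.
have sle x u r : (forall i, G i x u <= r) -> s <= r.
  by move=> h; apply: ge_inf; [case: Vinf|exists x, u].
have /choice [xu Gxu] (n : nat) : exists xu : E * F,
    forall i, G i xu.1 xu.2 <= s + n.+1%:R^-1.
  have n0 : 0 < n.+1%:R^-1 :> R by rewrite invr_gt0.
  have [r [x [u h]] rs] := inf_adherent n0 Vinf.
  by exists (x, u) => i /=; rewrite (le_trans (h i)) ?ltW.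
(* No upper bound at the midpoint of two near-minimizers lies below [s], so they must be close. *)
have dist N n : (N <= n)%N ->
    c * (`|(xu N).1 - (xu n).1| ^+ 2 + `|(xu N).2 - (xu n).2| ^+ 2) <= N.+1%:R^-1.
  move=> Nn; set d := _ + _.
  suff : s <= s + N.+1%:R^-1 - c * d by move: (c * d) N.+1%:R^-1 => ? ? ?; lra.
  apply: (sle (2^-1 *: ((xu N).1 + (xu n).1)) (2^-1 *: ((xu N).2 + (xu n).2))) => i.
  have nN : (n.+1%:R^-1 : R) <= N.+1%:R^-1 by rewrite lef_pV2 ?posrE ?ltr0n // ler_nat.
  have := Gc i (xu N).1 (xu n).1 (xu N).2 (xu n).2; rewrite -/d.
  move: (Gxu N i) (Gxu n i) nN; set a := n.+1%:R^-1; set b := N.+1%:R^-1.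
  by set e := c * d; move=> *; lra.
have small (e : R) : 0 < e -> exists N : nat, N.+1%:R^-1 < c * e ^+ 2.
  move=> e0; have ce : 0 < c * e ^+ 2 by rewrite mulr_gt0 ?exprn_gt0.
  by have [N] := ltr_add_invr ce; rewrite add0r => ?; exists N.
have [a xa] : exists a : E, (fun n => (xu n).1) @ \oo --> a.
  apply: seq_cauchy_cvg => d d0; have [N Nd] := small d d0; exists N => n Nn.
  rewrite -(@ltr_pXn2r _ 2) ?nnegrE // ?ltW // -(ltr_pM2l c0).
  apply: le_lt_trans Nd; apply: le_trans (dist _ _ Nn).
  by rewrite ler_pM2l // lerDl sqr_ge0.
have [b ub] : exists b : F, (fun n => (xu n).2) @ \oo --> b.
  apply: (@seq_cauchy_cvg R F) => e e0; have [N Ne] := small e e0; exists N => n Nn.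
  rewrite -(@ltr_pXn2r _ 2) ?nnegrE // ?ltW // -(ltr_pM2l c0).
  apply: le_lt_trans Ne; apply: le_trans (dist _ _ Nn).
  by rewrite ler_pM2l // lerDr sqr_ge0.
exists a, b, s; split => // i.
have h1 := Gcont i _ _ _ _ xa ub.
have h2 : s + n.+1%:R^-1 @[n --> \oo] --> s + (0 : R).
  by apply: cvgD; [exact: cvg_cst|exact: cvg_harmonic].
rewrite -[leRHS]addr0 -(cvg_lim _ h1) // -(cvg_lim _ h2) //.
apply: ler_lim; [by apply/cvg_ex; eexists; exact: h1
  |by apply/cvg_ex; eexists; exact: h2|exact: nearW].
Qed.

Lemma parallelogram_mid {R : realType} {H : hilbertType R} (x y : H) :
  `|2^-1 *: (x + y)| ^+ 2 =
    (`|x| ^+ 2 + `|y| ^+ 2) / 2 - 4^-1 * `|x - y| ^+ 2.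
Proof. by rewrite -!inner_norm !innerE (innerC y x); field. Qed.

(** First-order optimality without derivatives: for small [t] the linear term dominates. *)
Lemma slope_ge0 {R : realType} (a b : R) :
  (forall t, 0 < t -> t <= 1 -> 0 <= t * a + t ^+ 2 * b) -> 0 <= a.
Proof.
move=> h; rewrite leNgt; apply/negP => a0.
have d0 : 0 < 2 * (`|b| + 1) - a by have := normr_ge0 b; lra.
(* This [t] is at most 1 and satisfies [t * |b| < - a / 2], so [a + t * b] would be negative. *)
pose t := - a / (2 * (`|b| + 1) - a).
have t0 : 0 < t by rewrite divr_gt0 // oppr_gt0.
have t1 : t <= 1 by rewrite ler_pdivrMr // mul1r; have := normr_ge0 b; lra.
have := h t t0 t1; rewrite expr2 -mulrA -mulrDr pmulr_rge0 //.
have tE : t * (2 * (`|b| + 1) - a) = - a by rewrite divfK // gt_eqF.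
have tb : t * b <= t * `|b| by rewrite ler_pM2l // ler_norm.
by nra.
Qed.

(** The minimizer [a] of [|x| ^+ 2 / 2 - f x] represents [f]: its optimality in the directions [d]
    and [- d] forces [f d = <| a, d |>]. *)
Lemma riesz_representation {R : realType} {H : hilbertType R} (f : H -> R) (M : R) :
  (forall a x y, f (a *: x + y) = a * f x + f y) ->
  (forall x, `|f x| <= M * `|x|) ->
  exists l, forall x, f x = <| l, x |>.
Proof.
move=> flin fM.
(* The variable [u] is a dummy that fits the two-variable minimization lemma. *)
pose G (_ : unit) (x u : H) := `|x| ^+ 2 / 2 + `|u| ^+ 2 / 2 - f x.
have f0 : f 0 = 0 by have := flin (-1) 0 0; rewrite scaler0 addr0; lra.
have fD x y : f (x + y) = f x + f y by rewrite -[x]scale1r flin mul1r scale1r.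
have fZ a x : f (a *: x) = a * f x by rewrite -[_ *: _]addr0 flin f0 addr0.
have fN x : f (- x) = - f x by rewrite -[- x]scaleN1r fZ mulN1r.
(* [8^-1] is half the constant of [parallelogram_mid]; [- M ^+ 2 / 2] is the least value of
   [t ^+ 2 / 2 - M * t]. *)
have [|||||a [b [r [Gr rmin]]]] :=
    @sup_strongly_convex_min R H H unit G 8^-1 (- M ^+ 2 / 2).
- by [].
- by exists 0, 0, (G tt 0 0) => -[].
- move=> x u r /(_ tt) /(le_trans _); apply; rewrite /G.
  have := fM x; have := ler_norm (f x); have := sqr_ge0 (`|x| - M).
  by have := sqr_ge0 `|u|; rewrite !expr2; nra.
- move=> i x y u v; rewrite /G !parallelogram_mid fZ fD; lra.
- move=> i x u a b xa ub; apply: cvgB.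
    by apply: cvgD; apply: cvgMl; apply: cvgM; exact: cvg_norm.
  apply/cvgrPdist_le => e e0.
  have d0 : 0 < e / (`|M| + 1) by rewrite divr_gt0 // ltr_wpDl.
  move/cvgrPdist_le : xa => /(_ _ d0); apply: filterS => n hn.
  rewrite (_ : f a - f (x n) = f (a - x n)); last by rewrite fD fN.
  rewrite (le_trans (fM _))// (le_trans (ler_wpM2r (normr_ge0 _) (ler_norm _)))//.
  rewrite (le_trans (ler_wpM2l (normr_ge0 _) hn))//.
  by rewrite mulrCA ger_pMr // ler_pdivrMr ?ltr_wpDl// mul1r lerDl.
exists a.
have fle d : 0 <= <| a, d |> - f d.
  apply: (@slope_ge0 _ _ (`|d| ^+ 2 / 2)) => t t0 _.
  have := le_trans (Gr tt) (rmin (a + t *: d) b _ (fun=> lexx _)).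
  rewrite /G fD fZ -[X in _ <= X / 2 + _ - _]inner_norm !innerE (innerC d a).
  rewrite !inner_norm.
  lra.
move=> d; have := fle d; have := fle (- d); rewrite fN innerE; lra.
Qed.

(** * Maximal monotonicity, Minty's theorem and Lipschitz perturbations *)

(** Adjoining [(x, u)] to the graph keeps it monotone, so maximality puts the pair in the graph
    already. *)
Lemma maximally_monotoneP {R : realType} {H : hilbertType R} (T : H -> set H) (x u : H) :
  maximally_monotone T ->
  (forall y v, T y v -> 0 <= <| x - y, u - v |>) -> T x u.
Proof.
move=> [Tmon Tmax] rel.
pose N y := [set v | T y v \/ y = x /\ v = u].
have Nmon : monotone_op N.
  move=> y v y' v'; rewrite /gr /= => -[Tyv|[-> ->]] [Tyv'|[-> ->]]; [exact: Tmon|..|].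
  - by rewrite -opprB -[v - u]opprB innerNl innerNr opprK; exact: rel.
  - exact: rel.
  - by rewrite subrr inner0l.
have /(congr1 (fun S : set (H * H) => S (x, u))) : gr N = gr T.
  by apply: Tmax => // -[y v] Tyv; left.
by rewrite /gr /= => <-; right.
Qed.

(* The Fitzpatrick function of T plus half the square norm of H * H has a minimizer
   (x, u); its optimality condition says that (-u, -x) is monotonically
   related to the graph of T, and then x = - u. *)
Lemma minty_zero {R : realType} {H : hilbertType R} (T : H -> set H) :
  monotone_op T ->
  (forall x u, (forall y v, T y v -> 0 <= <| x - y, u - v |>) -> T x u) ->
  exists x, T x (- x).
Proof.
move=> Tmon Tmax.
(* Every pair is monotonically related to an empty graph, so the graph has a point. *)
have [y0 [v0 Tyv0]] : exists y v, T y v.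
  apply: contrapT => nT; apply: (nT); exists 0, 0; apply: Tmax => y v Tyv.
  by exfalso; apply: nT; exists y, v.
pose I := {yv : H * H | T yv.1 yv.2}.
pose K (i : I) (x u : H) :=
  <| x, (sval i).2 |> + <| (sval i).1, u |> - <| (sval i).1, (sval i).2 |>.
pose G i x u := K i x u + `|x| ^+ 2 / 2 + `|u| ^+ 2 / 2.
(* The Fitzpatrick function dominates the duality product: a bound [r] below [<| x, u |>] would put
   [(x, u)] in the graph, and the index [(x, u)] then yields [<| x, u |> <= r]. *)
have Kge x u r : (forall i, K i x u <= r) -> <| x, u |> <= r.
  move=> Kr; rewrite leNgt; apply/negP => rxu.
  have Txu : T x u.
    apply: Tmax => y v Tyv; have := Kr (exist _ (y, v) Tyv).
    rewrite /K /= !innerE; lra.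
  by have := Kr (exist _ (x, u) Txu); rewrite /K /=; lra.
have Gge x u r : (forall i, G i x u <= r) -> `|x + u| ^+ 2 / 2 <= r.
  move=> Gr; rewrite -inner_norm !innerE (innerC u x) !inner_norm.
  have := Kge x u (r - `|x| ^+ 2 / 2 - `|u| ^+ 2 / 2).
  have h i : K i x u <= r - `|x| ^+ 2 / 2 - `|u| ^+ 2 / 2.
    by have := Gr i; rewrite /G; lra.
  by move=> /(_ h); lra.
have [|||||a [b [r [Gr rmin]]]] := @sup_strongly_convex_min R H H I G 8^-1 0.
- by [].
- exists y0, v0, (<| y0, v0 |> + `|y0| ^+ 2 / 2 + `|v0| ^+ 2 / 2) => -[[y v] Tyv].
  rewrite /G /K /=.
  by have := Tmon _ _ _ _ Tyv0 Tyv; rewrite !innerE; lra.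
- by move=> x u r /Gge; apply: le_trans; rewrite divr_ge0 // sqr_ge0.
- move=> [[y v] Tyv] x x' u u'; rewrite /G /K /= !parallelogram_mid !innerE; lra.
- move=> [[y v] Tyv] x u a b xa ub; rewrite /G /K /=.
  apply: cvgD; [apply: cvgD|]; try by apply: cvgMl; apply: cvgM; exact: cvg_norm.
  apply: cvgB; last exact: cvg_cst.
  apply: cvgD; first exact: inner_cvgl.
  by under eq_fun do rewrite innerC; rewrite innerC; exact: inner_cvgl.
(* Optimality at [(a, b)] along the segment towards the graph point [(y, v)], where monotonicity
   bounds the Fitzpatrick function by [<| y, v |>]. *)
have rel y v : T y v -> `|a + b| ^+ 2 / 2 <= <| b + y, a + v |>.
  move=> Tyv; pose q := `|a| ^+ 2 / 2 + `|b| ^+ 2 / 2.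
  have r0 : 0 <= r by apply: le_trans (Gge _ _ _ Gr); rewrite divr_ge0 // sqr_ge0.
  suff : 0 <= <| y, v |> + <| a, y |> + <| b, v |> - q - r.
    rewrite -inner_norm !innerE (innerC y a) (innerC b a) !inner_norm /q; lra.
  apply: (@slope_ge0 _ _ ((`|y - a| ^+ 2 + `|v - b| ^+ 2) / 2)) => t t0 t1.
  have Kt i : G i (a + t *: (y - a)) (b + t *: (v - b)) <=
      (1 - t) * (r - q) + t * <| y, v |> +
      (`|a + t *: (y - a)| ^+ 2 + `|b + t *: (v - b)| ^+ 2) / 2.
    have : K i a b <= r - q by have := Gr i; rewrite /G /q; lra.
    have : K i y v <= <| y, v |>.
      case: i => -[y' v'] Tyv'; rewrite /K /=.
      by have := Tmon _ _ _ _ Tyv Tyv'; rewrite !innerE; lra.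
    move=> /(ler_wpM2l (ltW t0)) h1; have t1' : 0 <= 1 - t by lra.
    move=> /(ler_wpM2l t1') h2; move: h1 h2; rewrite /G /K !innerE; lra.
  have sq (x d : H) : `|x + t *: (d - x)| ^+ 2 =
      `|x| ^+ 2 + 2 * t * (<| x, d |> - `|x| ^+ 2) + t ^+ 2 * `|d - x| ^+ 2.
    by rewrite -!inner_norm !innerE (innerC d x); ring.
  by have := rmin _ _ _ Kt; rewrite !sq /q; lra.
have Tba : T (- b) (- a).
  apply: Tmax => y v /rel; rewrite -!opprD innerNl innerNr opprK; apply: le_trans.
  by rewrite divr_ge0 // sqr_ge0.
(* At the graph point [(- b, - a)] itself the right side of [rel] vanishes. *)
have /eqP : a + b = 0.
  apply/eqP; rewrite -normr_eq0 -sqrf_eq0 eq_le sqr_ge0 andbT.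
  by have := rel _ _ Tba; rewrite subrr inner0l; lra.
move=> /eqP/eqP; rewrite addr_eq0 => /eqP ab; exists a.
by rewrite {1}ab.
Qed.

(** Apply [minty_zero] to the operator [k T - y], which inherits monotonicity and maximality from
    [T]. *)
Lemma minty {R : realType} {H : hilbertType R} (T : H -> set H) (k : R) (y : H) :
  maximally_monotone T -> 0 < k -> exists x u, T x u /\ x + k *: u = y.
Proof.
move=> Tm k0; have k1 : k != 0 by rewrite gt_eqF.
have [||x Tx] := @minty_zero R H (fun x => [set u | T x (k^-1 *: (u + y))]).
- move=> x u z v Tu Tv; have := Tm.1 x (k^-1 *: (u + y)) z (k^-1 *: (v + y)) Tu Tv.
  by rewrite -scalerBr opprD addrACA subrr addr0 innerZr pmulr_rge0 // invr_gt0.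
- move=> x u rel; apply: maximally_monotoneP => // z v Tzv.
  have := rel z (k *: v - y); rewrite /= subrK scalerA mulVf // scale1r => /(_ Tzv).
  rewrite -(pmulr_rge0 _ (_ : 0 < k^-1)) ?invr_gt0 // -innerZr.
  by rewrite opprB addrA scalerBr scalerA mulVf // scale1r.
- exists x, (k^-1 *: (- x + y)); split => //.
  by rewrite scalerA mulfV // scale1r addrA subrr add0r.
Qed.

(** A fixed point [w] of [y |-> J (l - k *: D y)], with [J] the resolvent of [k T], satisfies
    [l - w = k *: (u + D w)] for some [u] in [T w]. The hypothesis at [(w, u)] then reads
    [0 <= - |l - w| ^+ 2], so [w = l]. The choice of [k] gives the map the contraction factor
    1/2. *)
Lemma zero_lipschitz_sum {R : realType} {H : hilbertType R} (T : H -> set H)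
    (D : H -> H) (L : R) (l : H) :
  maximally_monotone T -> 0 < L -> L.-lipschitz D ->
  (forall x u, T x u -> 0 <= <| u + D x, x - l |>) -> T l (- D l).
Proof.
move=> Tm L0 Dlip hl; pose k := (2 * L)^-1.
have k0 : 0 < k by rewrite invr_gt0 mulr_gt0.
have /choice [J JT] (y : H) : exists x, exists u, T x u /\ x + k *: u = y.
  exact: minty.
(* Resolvents are nonexpansive: monotonicity gives [|J a - J b| ^+ 2 <= <| J a - J b, a - b |>]. *)
have Jle a b : `|J a - J b| <= `|a - b|.
  have [u [Tu eu]] := JT a; have [v [Tv ev]] := JT b.
  have [->|n0] := eqVneq (J a - J b) 0; first by rewrite normr0.
  rewrite -(ler_pM2l (_ : 0 < `|J a - J b|)) ?normr_gt0 //.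
  apply: le_trans (le_trans (ler_norm _) (cauchy_schwarz _ _)).
  rewrite -expr2 -inner_norm -[X in X - b]eu -[X in _ - X]ev opprD addrACA -scalerBr.
  rewrite [leRHS]innerDr lerDl innerZr mulr_ge0 //; first exact: ltW.
  exact: (Tm.1 (J a) u (J b) v Tu Tv).
pose f y := J (l - k *: D y).
have fS : set_fun setT setT f by [].
pose g : {fun [set: H] >-> [set: H]} := mkfun fS.
have gctr : is_contraction g.
  exists 2^-1%:nng; split => /=; first by lra.
  move=> [x y] /= _; rewrite /f; apply: (le_trans (Jle _ _)).
  rewrite opprB addrC addrA subrK -scalerBr normrZ (gtr0_norm k0) distrC.
  rewrite -ler_pdivlMl // (le_trans (Dlip (x, y) _)) //= mulrA ler_wpM2r //.
  by rewrite invrK; lra.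
have [w _ wg] := banach_fixed_point gctr closedT (ex_intro _ 0 I).
have [u [Tu eu]] := JT (l - k *: D w).
have wf : J (l - k *: D w) = w by rewrite [RHS]wg.
rewrite wf in Tu eu.
have ulw : k *: (u + D w) = l - w.
  by rewrite scalerDr -[l](subrK (k *: D w)) -eu addrAC [w + _]addrC addrK.
have lw : l = w.
  apply/eqP; rewrite -subr_eq0 -normr_eq0 -sqrf_eq0 eq_le sqr_ge0 andbT.
  have := hl _ _ Tu; rewrite -(pmulr_rge0 _ k0) -innerZl ulw -[w - l]opprB innerNr.
  by rewrite inner_norm oppr_ge0.
have /eqP : k *: (u + D w) = 0 by rewrite ulw lw subrr.
by rewrite scaler_eq0 gt_eqF //= addr_eq0 lw => /eqP <-.
Qed.

(** * Weak limits along ultrafilters *)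

(** If a neighbourhood [A] of [l] fails, [F] restricted to the points sent outside [A] is proper,
    and an ultrafilter above it contradicts the hypothesis. *)
Lemma cvg_ultrafilterP {T : Type} {V : topologicalType} (F : set_system T)
    (f : T -> V) (l : V) :
  Filter F ->
  (forall U : set_system T, UltraFilter U -> F `<=` U -> f x @[x --> U] --> l) ->
  f x @[x --> F] --> l.
Proof.
move=> FF h A lA; apply: contrapT => nFA.
pose B := f @^-1` (~` A).
have WP : ProperFilter (within B F).
  apply: Build_ProperFilter_ex => P WPP; apply: contrapT => nP; apply: nFA.
  apply: (@filterS _ F _ _ (f @^-1` A) _ WPP) => t BP; apply: contrapT => nA; apply: nP.
  by exists t; exact: BP.
have [U [UU WU]] := ultraFilterLemma WP.
have UB : U B by apply: WU; apply: withinT.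
have UA : U (f @^-1` A).
  by apply: (h U UU) lA => P FP; apply: WU; apply: filterS FP => t.
have [t [Bt At]] := filter_ex (filterI UB UA).
exact: Bt At.
Qed.

Lemma fmap_ultrafilter {T V : Type} (f : T -> V) (U : set_system T) :
  UltraFilter U -> UltraFilter (f @ U).
Proof.
move=> UU; have UP : ProperFilter U := @ultra_proper _ _ UU.
split; first exact: fmap_proper_filter.
move=> G GP sG; apply/seteqP; split => // A GA.
have [//|nA] := in_ultra_setVsetC (f @^-1` A) UU.
have [v [Av nAv]] := filter_ex (filterI GA (sG (~` A) nA)).
by [].
Qed.

(** Compactness of the segment from [- M] to [M]. *)
Lemma ultrafilter_bounded_cvg {R : realType} {T : Type} (U : set_system T)
    (a : T -> R) (M : R) :
  UltraFilter U -> (forall t, `|a t| <= M) -> exists r : R, a t @[t --> U] --> r.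
Proof.
move=> UU aM; have := @segment_compact R (- M) M; rewrite compact_ultra.
move=> /(_ (a @ U) (fmap_ultrafilter a U UU)) [|r [_ ar]]; last by exists r.
by apply: nearW => t; rewrite /= in_itv /= -ler_norml.
Qed.

(** Weak compactness of balls: the scalar limits along [U] form a bounded linear functional of [d],
    which Riesz representation turns into a vector. *)
Lemma ultrafilter_weak_cvg {R : realType} {H : hilbertType R} {T : Type}
    (U : set_system T) (z : T -> H) (M : R) :
  UltraFilter U -> (forall t, `|z t| <= M) ->
  exists l, forall d, <| z t, d |> @[t --> U] --> <| l, d |>.
Proof.
move=> UU zM.
have UP : ProperFilter U := @ultra_proper _ _ UU.
have zd d t : `|<| z t, d |>| <= M * `|d|.
  by rewrite (le_trans (cauchy_schwarz _ _)) // ler_wpM2r.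
have /choice [f zf] (d : H) : exists r, <| z t, d |> @[t --> U] --> (r : R).
  exact: ultrafilter_bounded_cvg (zd d).
have [|d|l fl] := @riesz_representation R H f M.
- move=> a x y; have h : <| z t, a *: x + y |> @[t --> U] --> a * f x + f y.
    under eq_fun do rewrite innerDr innerZr.
    by apply: cvgD => //; apply: cvgMr.
  exact: cvg_unique (zf _) h.
- have h : `|<| z t, d |>| @[t --> U] --> `|f d| by exact: cvg_norm.
  rewrite -(cvg_lim _ h) //.
  by apply: limr_le; [apply/cvg_ex; eexists; exact: h|exact: nearW].
- by exists l => d; rewrite -fl.
Qed.

(** Two ultrafilter limits [l0] and [l] have the same product with [l0 - l], namely the limit of
    [<| z n, l0 - l |>]; hence [|l0 - l| ^+ 2 = 0]. *)
Lemma opial_passty {R : realType} {H : hilbertType R} (F : set H)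
    (z : nat -> H) (M : R) :
  (forall n, `|z n| <= M) ->
  (forall U l, UltraFilter U -> \oo `<=` U ->
    (forall d, <| z n, d |> @[n --> U] --> <| l, d |>) -> F l) ->
  (forall l1 l2, F l1 -> F l2 -> cvg (<| z n, l1 - l2 |> @[n --> \oo])) ->
  exists2 l, F l & weak_cvg z l.
Proof.
move=> zM zF zcvg.
have [U0 [UU0 sU0]] := ultraFilterLemma (@eventually_filter).
have [l0 zl0] := ultrafilter_weak_cvg U0 z M UU0 zM.
have Fl0 := zF _ _ UU0 sU0 zl0.
exists l0 => // d; apply: cvg_ultrafilterP => U UU sU.
have [l zl] := ultrafilter_weak_cvg U z M UU zM.
suff -> : l0 = l by exact: zl.
have Fl := zF _ _ UU sU zl.
have /cvg_ex [r zr] := zcvg _ _ Fl0 Fl.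
have UP : ProperFilter U := @ultra_proper _ _ UU.
have UP0 : ProperFilter U0 := @ultra_proper _ _ UU0.
have e0 : <| l0, l0 - l |> = r.
  by apply: cvg_unique (zl0 _) _; [|exact: cvg_trans (cvg_app _ sU0) zr].
have e1 : <| l, l0 - l |> = r.
  by apply: cvg_unique (zl _) _; [|exact: cvg_trans (cvg_app _ sU) zr].
apply/eqP; rewrite -subr_eq0 -normr_eq0 -sqrf_eq0 -inner_norm.
by rewrite [X in X == _]innerDl innerNl e0 e1 subrr.
Qed.

(** * Real sequences, series and upper limits *)

(** The weighted error splits at [N]: the head is a constant [K], negligible against the diverging
    total weight, and each later error is at most [e / 2]. *)
Lemma weighted_cesaro {R : realType} (w a : nat -> R) (L : R) :
  (forall n, (1 <= n)%N -> 0 < w n) ->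
  \sum_(1 <= k < n.+1) w k @[n --> \oo] --> +oo ->
  a @ \oo --> L ->
  (\sum_(1 <= k < n.+1) w k)^-1 * \sum_(1 <= k < n.+1) w k * a k @[n --> \oo] --> L.
Proof.
move=> w0 Sy aL; pose S n := \sum_(1 <= k < n.+1) w k.
apply/cvgrPdist_le => e e0.
have e20 : 0 < e / 2 by rewrite divr_gt0.
move/cvgrPdist_le : aL => /(_ _ e20) [N _ aN].
pose K := \sum_(1 <= k < N.+1) w k * `|L - a k|.
have [N1 _ SN1] : \forall n \near \oo, 2 * K / e <= S n by move/cvgryPge : Sy; apply.
exists (N + N1).+1 => // n /= Nn.
have nN : (N <= n)%N by apply: leq_trans Nn; rewrite ltnW // ltnS leq_addr.
have nN1 : (N1 <= n)%N by apply: leq_trans Nn; rewrite ltnW // ltnS leq_addl.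
have n0 : (0 < n)%N by apply: leq_ltn_trans Nn.
have Sn0 : 0 < S n.
  rewrite /S big_nat_recr //= ltr_wpDl ?w0 // big_nat sumr_ge0 // => i /andP[i1 _].
  by rewrite ltW ?w0.
have -> : L - (S n)^-1 * (\sum_(1 <= k < n.+1) w k * a k) =
    (S n)^-1 * \sum_(1 <= k < n.+1) w k * (L - a k).
  under [in RHS]eq_bigr do rewrite mulrBr.
  by rewrite sumrB -mulr_suml mulrBr mulrA mulVf ?mul1r // gt_eqF.
rewrite normrM normfV (gtr0_norm Sn0) ler_pdivrMl //.
apply: (le_trans (ler_norm_sum _ _ _)).
apply: (@le_trans _ _ (K + e / 2 * S n)); last first.
  by have := SN1 n nN1; rewrite /= ler_pdivrMr //; lra.
have wle k : (1 <= k)%N -> `|w k * (L - a k)| = w k * `|L - a k|.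
  by move=> k1; rewrite normrM gtr0_norm ?w0.
rewrite (big_cat_nat (n := N.+1)) //=; apply: lerD.
  by rewrite /K [leLHS]big_nat [leRHS]big_nat ler_sum // => k /andP[k1 _]; rewrite wle.
rewrite /S (@big_cat_nat _ _ _ N.+1 1 n.+1) //= mulrDr ler_wpDl //.
  rewrite mulr_ge0 ?(ltW e20) // big_nat sumr_ge0 // => k /andP[k1 _].
  by rewrite ltW ?w0.
rewrite mulr_sumr [leLHS]big_nat [leRHS]big_nat ler_sum // => k /andP[kN _].
have k1 : (1 <= k)%N by apply: leq_trans kN.
by rewrite wle // mulrC ler_wpM2r ?(ltW (w0 _ k1)) // aN //= ltnW.
Qed.

(** [a - series e] is nonincreasing and bounded below by [- M], and [d n] is squeezed by
    [a n - a n.+1 + e n]. *)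
Lemma quasi_fejer {R : realType} (a d e : nat -> R) (M : R) :
  (forall n, 0 <= a n) -> (forall n, 0 <= d n) -> (forall n, 0 <= e n) ->
  (forall n, a n.+1 + d n <= a n + e n) ->
  (forall n, \sum_(0 <= k < n) e k <= M) ->
  cvgn a /\ d @ \oo --> 0.
Proof.
move=> a0 d0 e0 ade eM.
have sercvg : cvgn (series e).
  apply: nondecreasing_is_cvgn; first exact/nondecreasing_series.
  by exists M => _ [n _ <-]; exact: eM.
have acvg : cvgn a.
  rewrite (_ : a = (fun n => a n - series e n) + series e); last first.
    by apply/funext => n; rewrite fctE subrK.
  apply: is_cvgD => //; apply: nonincreasing_is_cvgn.
    apply/nonincreasing_seqP => n; rewrite seriesSr.
    by have := ade n; have := d0 n; lra.
  exists (- M) => _ [n _ <-]; have := eM n; rewrite -[X in X <= _]/(series e n).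
  by have := a0 n; lra.
split => //.
have h : a n - a n.+1 + e n @[n --> \oo] --> (0 : R).
  rewrite -[X in _ --> X]addr0; apply: cvgD; last exact: cvg_series_cvg_0.
  rewrite -(subrr (limn a)); apply: cvgB => //.
  by rewrite (_ : (fun n => a n.+1) = [sequence a (n + 1)%N]_n) ?cvg_shiftn //;
    apply/funext => n /=; rewrite addn1.
apply: squeeze_cvgr (cvg_cst 0) h; apply: nearW => n; rewrite d0 /=.
by have := ade n; lra.
Qed.

(** Each nonnegative term lies below the finite sum, so it is a real number. *)
Lemma nneseries_lty_real {R : realType} (E : nat -> \bar R) :
  (forall n, (1 <= n)%N -> (0 <= E n)%E) -> (\sum_(1 <= n <oo) E n < +oo)%E ->
  exists (g : nat -> R) (M : R), (forall n, (1 <= n)%N -> E n = (g n)%:E) /\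
    forall n, \sum_(1 <= k < n) g k <= M.
Proof.
move=> E0 Es.
have Sfin : (\sum_(1 <= n <oo) E n)%E \is a fin_num.
  by rewrite ge0_fin_numE //; apply: nneseries_ge0 => n n1 _; exact: E0.
have le_S n : (\sum_(1 <= k < n) E k <= \sum_(1 <= n <oo) E n)%E.
  by apply: nneseries_lim_ge => k k1 _; exact: E0.
have Efin n : (1 <= n)%N -> E n = (fine (E n))%:E.
  move=> n1; rewrite fineK // ge0_fin_numE ?E0 //.
  apply: le_lt_trans Es; apply: le_trans (le_S n.+1).
  rewrite big_nat_recr //= leeDr // big_nat sume_ge0 // => k /andP[k1 _].
  exact: E0.
exists (fine \o E), (fine (\sum_(1 <= n <oo) E n)%E); split => // n.
rewrite -lee_fin fineK // -sumEFin; apply: le_trans (le_S n).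
by rewrite big_nat [leRHS]big_nat lee_sum // => k /andP[k1 _]; rewrite /= -Efin.
Qed.

Lemma not_ell1_sum_cvgy {R : realType} (a : nat -> R) :
  (forall n, (1 <= n)%N -> 0 < a n) -> ~ ell 1 a ->
  \sum_(1 <= k < n.+1) a k @[n --> \oo] --> +oo.
Proof.
move=> a0 na; apply/cvgryPge => A; apply: contrapT => nA; apply: na.
have Smono m n : (m <= n)%N -> \sum_(1 <= k < m) a k <= \sum_(1 <= k < n) a k.
  elim: n => [|n ih]; first by rewrite leqn0 => /eqP ->.
  rewrite leq_eqVlt => /orP[/eqP -> //|mn]; apply: (le_trans (ih mn)).
  case: n {ih mn} => [|n]; first by rewrite !big_geq.
  by rewrite [leRHS]big_nat_recr //= lerDl ltW // a0.
have SA n : \sum_(1 <= k < n.+1) a k <= A.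
  rewrite leNgt; apply/negP => An; apply: nA; exists n => // m /= nm.
  by rewrite (le_trans (ltW An)) // Smono.
rewrite /ell (@le_lt_trans _ _ A%:E) ?ltry //.
apply: lime_le.
  by apply: is_cvg_nneseries => n n1 _; rewrite lee_fin expr1.
apply: nearW => n; rewrite sumEFin lee_fin; apply: (le_trans _ (SA n)).
apply: (le_trans _ (Smono _ _ (leqnSn n))).
by rewrite [leLHS]big_nat [leRHS]big_nat ler_sum // => k /andP[k1 _];
  rewrite expr1 gtr0_norm // a0.
Qed.

(** The upper limit is an infimum of suprema over eventual sets; one of these lies below [b], and it
    is finite because it is at least [u N]. *)
Lemma limn_esup_lt_real {R : realType} (u : nat -> R) (b : R) :
  (limn_esup (fun n => (u n)%:E) < b%:E)%E ->
  exists c N, c < b /\ forall n, (N <= n)%N -> u n <= c.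
Proof.
move=> /ereal_inf_lt [_ [B [N _ NB] <-]] supb.
have le_sup n : (N <= n)%N -> ((u n)%:E <= ereal_sup [set (u k)%:E | k in B])%E.
  by move=> Nn; apply: ereal_sup_ubound; exists n => //; exact: NB.
have supfin : ereal_sup [set (u k)%:E | k in B] \is a fin_num.
  rewrite fin_real // (lt_le_trans (ltNyr (u N)) (le_sup _ (leqnn N))) /=.
  by rewrite (lt_trans supb) // ltry.
exists (fine (ereal_sup [set (u k)%:E | k in B])), N; split.
  by rewrite -lte_fin fineK.
by move=> n Nn; rewrite -lee_fin fineK // le_sup.
Qed.

(** * One Tseng iteration and its penalty term *)

(** With [m = p - u], [r = x - p] and the correction [e = x' - p], compare the squares of [m + e]
    and [m + r]. Their cross terms differ by [<| r - e, m |>], controlled by monotonicity and the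
    penalty gap, while [|e| <= c * |r|] by the Lipschitz bounds. *)
Lemma tseng_penalty_step {R : realType} {H : hilbertType R} (A : H -> set H)
    (D B : H -> H) (eta mu lam beta g : R) (x p x' u a v q : H) :
  monotone_op A -> monotone_op (single D) ->
  (eta^-1).-lipschitz D -> (mu^-1).-lipschitz B ->
  0 < lam -> 0 < beta ->
  A p a -> x - lam *: D x - (lam * beta) *: B x = p + lam *: a ->
  x' = (lam * beta) *: (B x - B p) + lam *: (D x - D p) + p ->
  A u v ->
  lam * beta * (<| u, B p |> + <| p, beta^-1 *: q |> - <| p, B p |>
    - <| u, beta^-1 *: q |>) <= g ->
  `|x' - u| ^+ 2 + (1 - (lam * beta / mu + lam / eta) ^+ 2) * `|x - p| ^+ 2 <=
    `|x - u| ^+ 2 + 2 * g + 2 * lam * <| v + D u + q, u - p |>.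
Proof.
move=> Amon Dmon Dlip Blip lam0 beta0 Apa xp x'E Auv gap.
have lb0 : 0 < lam * beta by rewrite mulr_gt0.
pose e := (lam * beta) *: (B x - B p) + lam *: (D x - D p).
pose c := lam * beta / mu + lam / eta.
have ele : `|e| ^+ 2 <= c ^+ 2 * `|x - p| ^+ 2.
  have Bxp : `|B x - B p| <= mu^-1 * `|x - p| by exact: (Blip (x, p)).
  have Dxp : `|D x - D p| <= eta^-1 * `|x - p| by exact: (Dlip (x, p)).
  have ele : `|e| <= c * `|x - p|.
    rewrite (le_trans (ler_normD _ _)) //.
    rewrite !normrZ (gtr0_norm lam0) (gtr0_norm beta0).
    by rewrite /c mulrDl -!(mulrA _ _ `|x - p|) lerD // ler_pM2l.
  by rewrite -exprMn ler_pXn2r ?nnegrE // (le_trans _ ele).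
(* The values of [B] and [D] at [x] cancel, leaving a step with every operator evaluated at [p]. *)
have rE : x - p = e + lam *: (a + beta *: B p + D p).
  have -> : x = p + (lam *: a + ((lam * beta) *: B x + lam *: D x)).
    by rewrite addrA -xp addrA !subrK.
  rewrite addrAC subrr add0r /e !scalerDr !scalerN scalerA.
  by rewrite [X in _ = X + _]addrACA -opprD -[X in _ = _ + X]addrA [RHS]addrCA subrK.
have mon1 : <| v, p - u |> <= <| a, p - u |>.
  have := Amon _ _ _ _ Apa Auv; rewrite innerC !innerE; lra.
have mon2 : <| D u, p - u |> <= <| D p, p - u |>.
  have := Dmon p (D p) u (D u) erefl erefl; rewrite innerC !innerE; lra.
(* The factor [beta] cancels [beta^-1] in the two terms containing [q]. *)
have gap' : lam * <| q, p - u |> - lam * beta * <| B p, p - u |> <= g.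
  apply: le_trans gap; rewrite le_eqVlt; apply/orP; left; apply/eqP.
  rewrite !innerE (innerC u (B p)) (innerC p (B p)) (innerC p q) (innerC u q).
  by field; rewrite gt_eqF.
have -> : x' - u = (p - u) + e by rewrite x'E -/e -addrA addrC.
have -> : x - u = (p - u) + (x - p) by rewrite [RHS]addrC addrA subrK.
have -> : <| v + D u + q, u - p |> = - <| v + D u + q, p - u |>.
  by rewrite -innerNr opprB.
have rm : <| x - p, p - u |> = <| e, p - u |> + lam * (<| a, p - u |>
    + beta * <| B p, p - u |> + <| D p, p - u |>).
  by rewrite {1}rE !(innerDl, innerZl).
move: mon1 mon2 gap' rm ele; rewrite -/c {x'E}; move: e c {rE} => e c.
move: (x - p) (p - u) => r m.
move=> /(ler_wpM2l (ltW lam0)) mon1 /(ler_wpM2l (ltW lam0)) mon2 gap' rm ele.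
rewrite -(inner_norm (m + e)) -(inner_norm (m + r)) !innerE (innerC m e) (innerC m r).
by rewrite rm !inner_norm; lra.
Qed.

(** Normality of [q] at [u] says that [u] maximizes [<| y, q |>] over [C]. *)
Lemma support_fun_normal_cone {R : realType} {H : hilbertType R} (C : set H)
    (u q : H) (b : R) :
  0 < b -> normal_cone C u q -> support_fun C (b *: q) = <| u, b *: q |>%:E.
Proof.
move=> b0 [Cu qu]; apply/eqP; rewrite eq_le; apply/andP; split.
  apply: ge_ereal_sup => _ [y Cy <-]; rewrite lee_fin -subr_ge0 !innerE.
  have := qu y Cy; rewrite !innerE (innerC q y) (innerC q u).
  by rewrite -mulrBr pmulr_rge0 // => ?; lra.
by apply: ereal_sup_ubound; exists u.
Qed.

(** Both suprema are bounded below by one choice: [u] in [C], then [(y, B y)] in the graph. The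
    choice [y = u], where [B u = 0], gives gap 0 and so nonnegative terms. *)
Lemma penalty_gap_real {R : realType} {H : hilbertType R} (B : H -> H) (C : set H)
    (lam beta : nat -> R) (u q : H) :
  C = zer (single B) ->
  (forall n, (1 <= n)%N -> 0 < lam n) -> (forall n, (1 <= n)%N -> 0 < beta n) ->
  normal_cone C u q ->
  (\sum_(1 <= n <oo) (lam n * beta n)%:E *
     (ereal_sup [set fitzpatrick (single B) y ((beta n)^-1 *: q) | y in C]
      - support_fun C ((beta n)^-1 *: q)) < +oo)%E ->
  exists (g : nat -> R) (M : R), [/\ forall n, (1 <= n)%N -> 0 <= g n,
    forall n, \sum_(1 <= k < n) g k <= M &
    forall n y, (1 <= n)%N -> lam n * beta n *
      (<| u, B y |> + <| y, (beta n)^-1 *: q |> - <| y, B y |>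
        - <| u, (beta n)^-1 *: q |>) <= g n].
Proof.
move=> CE lam0 beta0 Nuq Es; have [Cu _] := Nuq.
pose Phi n := ereal_sup [set fitzpatrick (single B) y ((beta n)^-1 *: q) | y in C].
have lePhi n y :
    ((<| u, B y |> + <| y, (beta n)^-1 *: q |> - <| y, B y |>)%:E <= Phi n)%E.
  apply: (@le_trans _ _ (fitzpatrick (single B) u ((beta n)^-1 *: q))).
    by apply: ereal_sup_ubound; exists (y, B y).
  by apply: ereal_sup_ubound; exists u.
have suppE n : (1 <= n)%N ->
    support_fun C ((beta n)^-1 *: q) = <| u, (beta n)^-1 *: q |>%:E.
  by move=> n1; apply: support_fun_normal_cone => //; rewrite invr_gt0 beta0.
have lb0 n : (1 <= n)%N -> 0 < lam n * beta n.
  by move=> n1; rewrite mulr_gt0 ?lam0 ?beta0.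
have le_term n y : (1 <= n)%N -> ((lam n * beta n *
      (<| u, B y |> + <| y, (beta n)^-1 *: q |> - <| y, B y |>
        - <| u, (beta n)^-1 *: q |>))%:E <=
      (lam n * beta n)%:E * (Phi n - support_fun C ((beta n)^-1 *: q)))%E.
  move=> n1; rewrite EFinM lee_pmul2l ?lte_fin ?lb0 // suppE //.
  by rewrite EFinB leeB.
have term0 n : (1 <= n)%N ->
    (0 <= (lam n * beta n)%:E * (Phi n - support_fun C ((beta n)^-1 *: q)))%E.
  move=> n1; apply: le_trans (le_term n u n1).
  have -> : B u = 0 by move: Cu; rewrite CE /zer /single /= => <-.
  by rewrite !inner0r add0r subr0 subrr mulr0.
have [g [M [gE gM]]] := nneseries_lty_real _ term0 Es.
exists g, M; split => // [n n1|n y n1].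
  by rewrite -lee_fin -gE // term0.
by rewrite -lee_fin -gE // le_term.
Qed.

Lemma zer_add3P {R : realType} {H : hilbertType R} (A N : H -> set H)
    (D : H -> H) (u : H) :
  zer (add_op (add_op A (single D)) N) u <->
  exists v q, [/\ A u v, N u q & v + D u + q = 0].
Proof.
split=> [[_ [v Av [_ -> <-]] [q Nq e]]|[v [q [Av Nq e]]]]; first by exists v, q.
by exists (v + D u); [exists v => //; exists (D u)|exists q].
Qed.

(** * Weak convergence of the weighted averages *)

Theorem theorem20 (R : realType) (H : hilbertType R)
  (A : H -> set H) (D B : H -> H) (eta mu : R) (C : set H)
  (lam beta : nat -> R) (x p : nat -> H) (tau : nat -> R) (z : nat -> H)
  (hA : maximally_monotone A)
  (heta : 0 < eta)
  (hDmon : monotone_op (single D)) (hDlip : (eta^-1).-lipschitz D)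
  (hmu : 0 < mu)
  (hBmon : monotone_op (single B)) (hBlip : (mu^-1).-lipschitz B)
  (hC : C = zer (single B)) (hC0 : C !=set0)
  (hlam : forall n, (1 <= n)%N -> 0 < lam n)
  (hbeta : forall n, (1 <= n)%N -> 0 < beta n)
  (hp : forall n, (1 <= n)%N ->
    resolvent (scale_op (lam n) A)
      (x n - lam n *: D (x n) - (lam n * beta n) *: B (x n)) = [set p n])
  (hx : forall n, (1 <= n)%N ->
    x n.+1 = (lam n * beta n) *: (B (x n) - B (p n))
             + lam n *: (D (x n) - D (p n)) + p n)
  (htau : forall n, (1 <= n)%N -> tau n = \sum_(1 <= k < n.+1) lam k)
  (hz : forall n, (1 <= n)%N ->
    z n = (tau n)^-1 *: \sum_(1 <= k < n.+1) lam k *: x k)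
  (h1max : maximally_monotone (add_op A (normal_cone C)))
  (h1zer : zer (add_op (add_op A (single D)) (normal_cone C)) !=set0)
  (h2 : forall q, ran (normal_cone C) q ->
    (\sum_(1 <= n <oo) (lam n * beta n)%:E *
       (ereal_sup [set fitzpatrick (single B) u ((beta n)^-1 *: q) | u in C]
        - support_fun C ((beta n)^-1 *: q)) < +oo)%E)
  (h3 : ell 2 lam /\ ~ ell 1 lam)
  (h4 : (limn_esup (fun n => (lam n * beta n / mu + lam n / eta)%:E)
         < 1%:E)%E) :
  exists2 l : H, zer (add_op (add_op A (single D)) (normal_cone C)) l
               & weak_cvg z l.
Proof.
pose F := zer (add_op (add_op A (single D)) (normal_cone C)).
have [c [N0 [c1 cN0]]] := limn_esup_lt_real _ _ h4.
(* The successor keeps all indices from [N] on positive, where the recursion holds. *)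
pose N := N0.+1.
have c0 : 0 <= c.
  apply: le_trans (cN0 N (leqnSn _)).
  by rewrite addr_ge0 // divr_ge0 // ltW // ?mulr_gt0 ?hlam ?hbeta.
have cN n : (N <= n)%N -> (lam n * beta n / mu + lam n / eta) ^+ 2 <= c ^+ 2.
  move=> Nn; have n1 : (1 <= n)%N by apply: leq_trans Nn.
  rewrite ler_pXn2r ?nnegrE //; first by apply: cN0; exact: ltnW.
  by rewrite addr_ge0 // divr_ge0 // ltW // ?mulr_gt0 ?hlam ?hbeta.
pose delta := 1 - c ^+ 2.
have delta0 : 0 < delta by rewrite subr_gt0 expr_lt1.
have pE n : (1 <= n)%N -> exists2 a, A (p n) a &
    x n - lam n *: D (x n) - (lam n * beta n) *: B (x n) = p n + lam n *: a.
  move=> n1; have : [set p n] (p n) by [].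
  by rewrite -hp // => -[_ -> [_ [a Aa <-] <-]]; exists a.
have step u v q : A u v -> normal_cone C u q ->
    exists (g : nat -> R) (M : R), [/\ forall n, (1 <= n)%N -> 0 <= g n,
      forall n, \sum_(1 <= k < n) g k <= M &
      forall n, (N <= n)%N -> `|x n.+1 - u| ^+ 2 + delta * `|x n - p n| ^+ 2 <=
        `|x n - u| ^+ 2 + 2 * g n + 2 * lam n * <| v + D u + q, u - p n |>].
  move=> Auv Nuq; have Es : ran (normal_cone C) q by exists u.
  have [g [M [g0 gM gap]]] := penalty_gap_real B C lam beta u q hC hlam hbeta Nuq (h2 q Es).
  exists g, M; split => // n Nn; have n1 : (1 <= n)%N by apply: leq_trans Nn.
  have [a Aa xa] := pE n n1.
  have := tseng_penalty_step A D B eta mu _ _ _ _ _ _ u a v q hA.1 hDmon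
    hDlip hBlip (hlam n n1) (hbeta n n1) Aa xa (hx n n1) Auv (gap n (p n) n1).
  apply: le_trans; rewrite lerD2l ler_wpM2r ?sqr_ge0 // lerD2l lerN2; exact: cN.
have fejer u : F u -> cvgn (fun n => `|x n - u| ^+ 2) /\
    (fun n => `|x n - p n|) @ \oo --> 0.
  move=> /zer_add3P [v [q [Auv Nuq w0]]].
  have [g [M [g0 gM hg]]] := step u v q Auv Nuq.
  (* Shifting by [N] confines the sequences to the range of [step]; with [w = 0] its inner product
     term vanishes. *)
  have [|||||acvg dcvg] := @quasi_fejer R (fun n => `|x (n + N)%N - u| ^+ 2)
      (fun n => delta * `|x (n + N)%N - p (n + N)%N| ^+ 2)
      (fun n => 2 * g (n + N)%N) (2 * M).
  - by move=> n; exact: sqr_ge0.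
  - by move=> n; rewrite mulr_ge0 ?sqr_ge0 // ltW.
  - by move=> n; rewrite mulr_ge0 // g0 // addnS.
  - move=> n; have := hg (n + N)%N (leq_addl _ _).
    by rewrite w0 inner0l mulr0 addr0.
  - move=> n; rewrite -mulr_sumr ler_wpM2l //.
    apply: le_trans (gM (n + N)%N).
    rewrite (@big_cat_nat _ _ _ N 1 (n + N)) ?leq_addl //=.
    rewrite -{3}[N]add0n big_addn addnK lerDr.
    by rewrite big_nat sumr_ge0 // => k /andP[k1 _]; exact: g0.
  split.
    have /cvg_ex [r ar] := acvg; apply/cvg_ex; exists r.
    by rewrite -(cvg_shiftn N).
  rewrite -(cvg_shiftn N) /=.
  have : Num.sqrt (delta^-1 * (delta * `|x (n + N)%N - p (n + N)%N| ^+ 2))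
      @[n --> \oo] --> Num.sqrt (delta^-1 * 0).
    by apply: continuous_cvg; [exact: sqrt_continuous|exact: cvgMr].
  rewrite mulr0 sqrtr0; apply: cvg_trans; apply: near_eq_cvg; apply: nearW => n.
  by rewrite mulrA mulVf ?gt_eqF // mul1r sqrtr_sqr normr_id.
have [u0 Fu0] := h1zer.
have [a0cvg xp0] := fejer u0 Fu0.
(* A bound on squared distances becomes one on norms through [t <= 1 + t ^+ 2]. *)
have [Mx xM] : exists M, forall n, `|x n| <= M.
  have [M [_ aM]] := cvg_seq_bounded a0cvg.
  exists (`|u0| + (1 + (M + 1))) => n.
  rewrite -{1}[x n](subrK u0) addrC (le_trans (ler_normD _ _)) // lerD2l.
  have := aM (M + 1) (ltr_pwDr ltr01 (lexx M)) n Logic.I.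
  rewrite /= ger0_norm ?sqr_ge0 //; have := sqr_ge0 (`|x n - u0| - 1).
  by rewrite !expr2; have := normr_ge0 (x n - u0); nra.
pose S n := \sum_(1 <= k < n.+1) lam k.
have Sy : S @ \oo --> +oo by apply: not_ell1_sum_cvgy => //; case: h3.
have S0 n : (1 <= n)%N -> 0 < S n.
  move=> n1; rewrite /S big_nat_recr //= ltr_wpDl ?hlam //.
  rewrite big_nat sumr_ge0 // => k /andP[k1 _].
  by rewrite ltW ?hlam.
have zE n : (1 <= n)%N -> z n = (S n)^-1 *: \sum_(1 <= k < n.+1) lam k *: x k.
  by move=> n1; rewrite hz // htau.
have zip n d : (1 <= n)%N ->
    <| z n, d |> = (S n)^-1 * \sum_(1 <= k < n.+1) lam k * <| x k, d |>.
  move=> n1; rewrite zE // innerZl inner_suml.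
  by under eq_bigr do rewrite innerZl.
(* [z 0] is arbitrary, so its norm enters the bound separately. *)
have zM n : `|z n| <= Mx + `|z 0%N|.
  case: n => [|n]; first by rewrite lerDr (le_trans _ (xM 0%N)).
  rewrite (@le_trans _ _ Mx) ?lerDl // zE // normrZ normfV (gtr0_norm (S0 _ _)) //.
  rewrite ler_pdivrMl ?S0 // mulrC (le_trans (ler_norm_sum _ _ _)) // mulr_sumr.
  rewrite [leLHS]big_nat [leRHS]big_nat ler_sum // => k /andP[k1 _].
  by rewrite normrZ gtr0_norm ?hlam // [leRHS]mulrC ler_pM2l ?hlam.
apply: (opial_passty F z _ zM).
- move=> U l UU sU zl.
  have UP : ProperFilter U := @ultra_proper _ _ UU.
  suff [v Av [q Nq vq]] : add_op A (normal_cone C) l (- D l).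
    by apply/zer_add3P; exists v, q; split => //; rewrite addrAC vq addNr.
  apply: (@zero_lipschitz_sum _ _ _ _ (eta^-1)) => //; first by rewrite invr_gt0.
  move=> u _ [v Auv [q Nuq <-]].
  have [g [M [g0 gM hg]]] := step u v q Auv Nuq.
  rewrite addrAC; set w := v + D u + q.
  (* [K] absorbs the terms before [N], so that the telescoped sums start at 1 as in [z n]. *)
  pose K := `|x N - u| ^+ 2 - 2 * \sum_(1 <= k < N) lam k * <| w, u - p k |>.
  have tele n : (N <= n)%N -> `|x n - u| ^+ 2 <= K + 2 * \sum_(1 <= k < n) g k +
      2 * \sum_(1 <= k < n) lam k * <| w, u - p k |>.
    elim: n => [//|n ih]; rewrite leq_eqVlt => /orP[/eqP <-|].
      rewrite /K addrAC subrK lerDl mulr_ge0 // big_nat sumr_ge0 // => k /andP[k1 _].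
      exact: g0.
    rewrite ltnS => Nn; have n1 : (1 <= n)%N by apply: leq_trans Nn.
    rewrite !big_nat_recr //=; have := ih Nn; have := hg n Nn.
    have : 0 <= delta * `|x n - p n| ^+ 2 by rewrite mulr_ge0 ?sqr_ge0 // ltW.
    by rewrite -/w; lra.
  (* [r] is the error of replacing [p k] by [x k] in the averages; it vanishes because [x k - p k]
     does. *)
  pose r n := (S n)^-1 * \sum_(1 <= k < n.+1) lam k * <| x k - p k, w |>.
  have r0 : r @ \oo --> 0.
    apply: weighted_cesaro => //; rewrite -(inner0l w).
    by apply: inner_cvgl; apply/norm_cvg0P.
  (* The telescoped inequality divided by [S n]: [h n] is nonnegative from [N] on and tends along
     [U] to [2 * <| u - l, w |>]. *)
  pose h n := (S n)^-1 * (K + 2 * M) + 2 * (<| u, w |> - <| z n, w |> + r n).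
  have SV0 : (S n)^-1 @[n --> \oo] --> 0.
    by apply/gtr0_cvgV0 => //; exists 1%N => // n /= n1; exact: S0.
  have hU : h @ U --> 0 * (K + 2 * M) + 2 * (<| u, w |> - <| l, w |> + 0).
    apply: cvgD.
      by apply: cvgMl; exact: cvg_trans (cvg_app _ sU) SV0.
    apply: cvgMr; apply: cvgD; last exact: cvg_trans (cvg_app _ sU) r0.
    by apply: cvgB; [exact: cvg_cst|exact: zl].
  have h0 : \forall n \near U, 0 <= h n.
    apply: sU; exists N => // n /= Nn; have n1 : (1 <= n)%N by apply: leq_trans Nn.
    have rw : <| u, w |> - <| z n, w |> + r n =
        (S n)^-1 * \sum_(1 <= k < n.+1) lam k * <| w, u - p k |>.
      have -> : \sum_(1 <= k < n.+1) lam k * <| w, u - p k |> = S n * <| u, w |>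
          - \sum_(1 <= k < n.+1) lam k * <| x k, w |>
          + \sum_(1 <= k < n.+1) lam k * <| x k - p k, w |>.
        rewrite /S mulr_suml -sumrB -big_split; apply: eq_bigr => k _ /=.
        by rewrite (innerC w) !innerE; ring.
      by rewrite zip // /r !mulrDr mulrN mulKf // gt_eqF // S0.
    rewrite /h rw mulrCA -mulrDr mulr_ge0 ?invr_ge0 ?(ltW (S0 n n1)) //.
    have := tele n.+1 (leqW Nn); have := gM n.+1; have := sqr_ge0 `|x n.+1 - u|.
    lra.
  have : 0 <= lim (h @ U) by apply: limr_ge h0; apply/cvg_ex; eexists; exact: hU.
  rewrite (cvg_lim _ hU) // mul0r add0r addr0 pmulr_rge0 //.
  by rewrite -innerNl -innerDl innerC.
- move=> l1 l2 Fl1 Fl2.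
  have /cvg_ex [b1 e1] := (fejer l1 Fl1).1; have /cvg_ex [b2 e2] := (fejer l2 Fl2).1.
  (* Polarization writes [<| x n, l1 - l2 |>] through the squared distances from [x n] to [l1] and
     [l2], both convergent. *)
  pose L := (b2 - b1 + (`|l1| ^+ 2 - `|l2| ^+ 2)) / 2.
  have xL : <| x n, l1 - l2 |> @[n --> \oo] --> L.
    rewrite (_ : (fun n => _) = (fun n => (`|x n - l2| ^+ 2 - `|x n - l1| ^+ 2
        + (`|l1| ^+ 2 - `|l2| ^+ 2)) / 2)).
      by apply: cvgMl; apply: cvgD; [exact: cvgB|exact: cvg_cst].
    apply/funext => n; rewrite -!inner_norm !innerE (innerC l1 (x n)) (innerC l2 (x n)).
    by field.
  apply/cvg_ex; exists L; have := weighted_cesaro _ _ _ hlam Sy xL.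
  apply: cvg_trans; apply: near_eq_cvg; exists 1%N => // n /= n1.
  by rewrite zip.
Qed.
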